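(* For every $\delta\in[0,0.08)$ there exist constants $C_0,C_1>0$, depending only on $\delta$, such that the following holds. Let $m,n,d,s$ be positive integers with $s\le d$, let $D\in\mathbb{R}^{n\times d}$ be an arbitrary tight frame (normalized so that $DD^*=I_n$), and let $A\in\mathbb{R}^{m\times n}$ be a measurement matrix satisfying the restricted isometry property adapted to $D$ (D-RIP) of order $2s$ with constant $\delta_{2s}=\delta$. Let $\varepsilon\ge 0$, let $f\in\mathbb{R}^n$, and let $y=Af+z$ with $z\in\mathbb{R}^m$, $\|z\|_2\le\varepsilon$. Then every solution $\hat f$ of the $\ell_1$-analysis problem $$\min_{\tilde f\in\mathbb{R}^n}\|D^*\tilde f\|_1\quad\text{subject to}\quad\|A\tilde f-y\|_2\le\varepsilon$$ satisfies $$\|\hat f-f\|_2\le C_0\,\varepsilon+C_1\,\frac{\|D^*f-(D^*f)_s\|_1}{\sqrt{s}}.$$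
   Context: $D^*$ denotes the (conjugate) transpose of $D$; $\|\cdot\|_2$ is the Euclidean norm and $\|\cdot\|_1$ the $\ell_1$-norm. A vector is $k$-sparse if it has at most $k$ nonzero entries. For a vector $x$, $x_s$ denotes a best $s$-sparse approximation of $x$ in $\ell_2$, i.e. the vector keeping the $s$ largest entries of $x$ in magnitude and setting the others to zero. D-RIP: for a positive integer $k$, let $\Sigma_k\subset\mathbb{R}^n$ be the union of all subspaces spanned by subsets of $k$ columns of $D$, that is, $\Sigma_k=\{Dx: x\in\mathbb{R}^d \text{ is } k\text{-sparse}\}$. The matrix $A$ obeys the restricted isometry property adapted to $D$ (D-RIP) of order $k$ with constant $\delta_k$ if $$(1-\delta_k)\|v\|_2^2\le\|Av\|_2^2\le(1+\delta_k)\|v\|_2^2\quad\text{for all } v\in\Sigma_k.$$ *)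

(* Defs.v *)
From mathcomp Require Import all_boot all_order all_algebra.
From mathcomp Require Import reals.

Set Implicit Arguments.
Unset Strict Implicit.
Unset Printing Implicit Defensive.
Import Order.TTheory GRing.Theory Num.Theory.
Local Open Scope ring_scope.

Definition norm2 (R : realType) (n : nat) (x : 'cV[R]_n) : R :=
  Num.sqrt (\sum_i x i 0 ^+ 2).

Definition norm1 (R : realType) (n : nat) (x : 'cV[R]_n) : R :=
  \sum_i `|x i 0|.

Definition sparse (R : realType) (n k : nat) (x : 'cV[R]_n) : Prop :=
  (#|[set i | x i 0 != 0]%R| <= k)%N.

(* [u] keeps [s] entries of [x] of largest magnitude and zeroes the others.
   This is a relation because ties make [u] non-unique; when [s <= n] at least
   one such [u] exists, and when [n < s] there is none. *)
Definition best_sparse_approx (R : realType) (n s : nat) (x u : 'cV[R]_n)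
    : Prop :=
  exists S : {set 'I_n},
    [/\ #|S| = s,
        forall i j, i \in S -> j \notin S -> `|x j 0| <= `|x i 0|
      & forall i, u i 0 = if i \in S then x i 0 else 0].

(* The union of the spans of [k] columns of [D]. *)
Definition Sigma_D (R : realType) (n d : nat) (D : 'M[R]_(n, d)) (k : nat)
    (v : 'cV[R]_n) : Prop :=
  exists2 x : 'cV[R]_d, sparse k x & v = D *m x.

(* [delta] is any admissible constant, not necessarily the smallest one. *)
Definition D_RIP (R : realType) (m n d : nat) (D : 'M[R]_(n, d))
    (A : 'M[R]_(m, n)) (k : nat) (delta : R) : Prop :=
  forall v : 'cV[R]_n, Sigma_D D k v ->
    (1 - delta) * norm2 v ^+ 2 <= norm2 (A *m v) ^+ 2 /\
    norm2 (A *m v) ^+ 2 <= (1 + delta) * norm2 v ^+ 2.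

Definition l1_analysis_solution (R : realType) (m n d : nat)
    (D : 'M[R]_(n, d)) (A : 'M[R]_(m, n)) (y : 'cV[R]_m) (eps : R)
    (fhat : 'cV[R]_n) : Prop :=
  norm2 (A *m fhat - y) <= eps /\
  forall g : 'cV[R]_n, norm2 (A *m g - y) <= eps ->
    norm1 (D^T *m fhat) <= norm1 (D^T *m g).

(* Main.v *)
(** Put [x := D^T h] for the error [h := fhat - f], so that [h = D x] and
    [|h| = |x|].  Minimality of [fhat] controls the [l1]-norm of [x] off the
    support [T0] of [(D^T f)_s] by its [l1]-norm on [T0].  Let [T1] carry the
    [s] largest entries of [x] off [T0], and let [u] be [x] restricted to
    [T0 :|: T1].  The columns of [D] need not be orthogonal, but
    [<D u, h> = <u, D^T h> = |u|^2] holds exactly.  By the D-RIP,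
    [<D u, h>] differs from [<A D u, A h>] by at most [3 delta |u|^2] plus a
    multiple of [|u|] times the tail [|D^T f - (D^T f)_s|_1 / sqrt s], while
    [|A h| <= 2 eps]; this bounds [|u|], and then [|x|]. *)
Require Import Defs.
From mathcomp Require Import all_boot all_order all_algebra.
From mathcomp Require Import reals.
From mathcomp Require Import lra.

Set Implicit Arguments.
Unset Strict Implicit.
Unset Printing Implicit Defensive.
Import Order.TTheory GRing.Theory Num.Theory.
Local Open Scope ring_scope.

(** * Inner product, Euclidean norm and tight frames *)

Section Inner.
Variable R : realType.
Implicit Types (n : nat) (a : R).

(** The matrix-product form lets bilinearity and adjointness come directly from matrix algebra. *)
Definition inner n (u v : 'cV[R]_n) : R := (u^T *m v) 0 0.

Lemma innerE n (u v : 'cV[R]_n) : inner u v = \sum_i u i 0 * v i 0.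
Proof. by rewrite /inner mxE; apply: eq_bigr => i _; rewrite mxE. Qed.

Lemma innerC n (u v : 'cV[R]_n) : inner u v = inner v u.
Proof. by rewrite !innerE; apply: eq_bigr => i _; rewrite mulrC. Qed.

Lemma innerDr n (u v w : 'cV[R]_n) : inner u (v + w) = inner u v + inner u w.
Proof. by rewrite /inner mulmxDr mxE. Qed.

Lemma innerZr n a (u v : 'cV[R]_n) : inner u (a *: v) = a * inner u v.
Proof. by rewrite /inner -scalemxAr mxE. Qed.

Lemma innerDl n (u v w : 'cV[R]_n) : inner (u + v) w = inner u w + inner v w.
Proof. by rewrite innerC innerDr !(innerC w). Qed.

Lemma innerZl n a (u v : 'cV[R]_n) : inner (a *: u) v = a * inner u v.
Proof. by rewrite innerC innerZr innerC. Qed.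

Lemma inner_mull m n (M : 'M[R]_(m, n)) u v : inner (M *m u) v = inner u (M^T *m v).
Proof. by rewrite /inner trmx_mul mulmxA. Qed.

Lemma inner_ge0 n (u : 'cV[R]_n) : 0 <= inner u u.
Proof. by rewrite innerE sumr_ge0 // => i _; rewrite -expr2 sqr_ge0. Qed.

Lemma norm2_sqr n (u : 'cV[R]_n) : norm2 u ^+ 2 = inner u u.
Proof.
rewrite /norm2 sqr_sqrtr; first by rewrite innerE.
by rewrite sumr_ge0 // => i _; rewrite sqr_ge0.
Qed.

Lemma norm2_ge0 n (u : 'cV[R]_n) : 0 <= norm2 u.
Proof. exact: sqrtr_ge0. Qed.

Lemma ler_norm2 n (u : 'cV[R]_n) c : 0 <= c -> inner u u <= c ^+ 2 -> norm2 u <= c.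
Proof. by move=> c0; rewrite -norm2_sqr ler_pXn2r ?nnegrE ?norm2_ge0. Qed.

(* The optimal choice is [a = q], [c = p]; when [p q = 0] one of [a], [c] is
   sent to infinity instead. *)
Lemma le_of_quadratic_bound (b p q K : R) : 0 <= p -> 0 <= q ->
  (forall a c, 2 * (a * c * b) <= K * (a ^+ 2 * p ^+ 2 + c ^+ 2 * q ^+ 2)) ->
  b <= K * (p * q).
Proof.
have aux (e : R) : (forall a : R, 2 * (a * b) <= e) -> b <= 0.
  move=> H; rewrite leNgt; apply/negP => b0.
  (* This choice of [a] makes [2 * (a * b)] equal to [e + 1], exceeding the bound. *)
  by have := H ((e + 1) / 2 / b); rewrite divfK ?gt_eqF //; lra.
move=> p0 q0 H; have [pE|pN0] := eqVneq p 0.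
  rewrite pE mul0r mulr0; apply: (aux (K * q ^+ 2)) => a.
  by have := H a 1; rewrite pE; lra.
have [qE|qN0] := eqVneq q 0.
  rewrite qE mulr0 mulr0; apply: (aux (K * p ^+ 2)) => a.
  by have := H 1 a; rewrite qE; lra.
have pq0 : 0 < p * q by rewrite mulr_gt0 // lt_def ?pN0 ?qN0.
rewrite -(ler_pM2l pq0); have := H q p; lra.
Qed.

(** Cauchy-Schwarz: nonnegativity of [|a u - c v|^2] is the quadratic bound with [K = 1]. *)
Lemma inner_le n (u v : 'cV[R]_n) : inner u v <= norm2 u * norm2 v.
Proof.
rewrite -[leRHS]mul1r; apply: le_of_quadratic_bound; rewrite ?norm2_ge0 //.
move=> a c; rewrite !norm2_sqr.
have := inner_ge0 (a *: u + (- c) *: v).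
by rewrite !(innerDl, innerDr, innerZl, innerZr) (innerC v u); lra.
Qed.

Lemma norm2D n (u v : 'cV[R]_n) : norm2 (u + v) <= norm2 u + norm2 v.
Proof.
apply: ler_norm2; first by rewrite addr_ge0 ?norm2_ge0.
rewrite sqrrD !norm2_sqr !(innerDl, innerDr) (innerC v u).
by have := inner_le u v; lra.
Qed.

Lemma norm2N n (u : 'cV[R]_n) : norm2 (- u) = norm2 u.
Proof. by rewrite /norm2; under eq_bigr do rewrite mxE sqrrN. Qed.

(** [D^T] is an isometry, so with [y = D x] one has [|y|^2 = <x, D^T y> <= |x| |y|]; then divide by
    [|y|]. *)
Lemma norm2_tight_frame n d (D : 'M[R]_(n, d)) (x : 'cV[R]_d) :
  D *m D^T = 1%:M -> norm2 (D *m x) <= norm2 x.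
Proof.
move=> DDT; have iso y : inner (D^T *m y) (D^T *m y) = inner y y.
  by rewrite inner_mull trmxK mulmxA DDT mul1mx.
set y := D *m x.
have E : norm2 (D^T *m y) = norm2 y.
  by apply/eqP; rewrite -(eqrXn2 (n := 2)) ?norm2_ge0 // !norm2_sqr iso.
have : norm2 y ^+ 2 <= norm2 x * norm2 y.
  by rewrite norm2_sqr -E {1}/y inner_mull inner_le.
have [->|yN0] := eqVneq (norm2 y) 0; first by rewrite norm2_ge0.
by rewrite expr2 ler_pM2r // lt_def yN0 norm2_ge0.
Qed.

End Inner.

(** * Restriction to index sets and decomposition into blocks *)

Section Restriction.
Variables (R : realType) (n : nat).
Implicit Types (x u v : 'cV[R]_n) (S T : {set 'I_n}) (s : nat).

Definition restr S x : 'cV[R]_n := \col_i (if i \in S then x i 0 else 0).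

Lemma restrE S x i : restr S x i 0 = if i \in S then x i 0 else 0.
Proof. by rewrite mxE. Qed.

Lemma restr_split S T x : T \subset S -> restr S x = restr T x + restr (S :\: T) x.
Proof.
move=> TS; apply/matrixP => i j; rewrite !mxE inE.
case: (boolP (i \in T)) => [/(subsetP TS) ->|_] /=; first by rewrite addr0.
by rewrite add0r.
Qed.

Lemma restrTC T x : x = restr T x + restr (~: T) x.
Proof.
apply/matrixP => i j; rewrite !mxE (ord1 j) inE.
by case: (i \in T); rewrite ?addr0 ?add0r.
Qed.

Lemma sparse_restr s S x : (#|S| <= s)%N -> sparse s (restr S x).
Proof.
apply: leq_trans; apply/subset_leq_card/subsetP => i.
by rewrite inE restrE; case: (i \in S); rewrite ?eqxx.
Qed.

Lemma norm1_restr S x : norm1 (restr S x) = \sum_(i in S) `|x i 0|.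
Proof.
rewrite /norm1 [RHS]big_mkcond; apply: eq_bigr => i _; rewrite restrE.
by case: (i \in S); rewrite ?normr0.
Qed.

Lemma norm1_restr_split S T x : T \subset S ->
  norm1 (restr S x) = norm1 (restr T x) + norm1 (restr (S :\: T) x).
Proof.
move=> TS; rewrite !norm1_restr (big_setID T) /=.
by move/setIidPr: TS => ->.
Qed.

Lemma inner_restr S x : inner (restr S x) (restr S x) = \sum_(i in S) x i 0 ^+ 2.
Proof.
rewrite innerE [RHS]big_mkcond; apply: eq_bigr => i _; rewrite restrE.
by case: (i \in S); rewrite ?mul0r ?expr2.
Qed.

Lemma inner_restrl S x : inner (restr S x) x = inner (restr S x) (restr S x).
Proof.
rewrite !innerE; apply: eq_bigr => i _; rewrite restrE.
by case: (i \in S); rewrite ?mul0r.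
Qed.

Lemma norm2_restr_le S T x : S \subset T -> norm2 (restr S x) <= norm2 (restr T x).
Proof.
move=> ST; apply: ler_norm2; rewrite ?norm2_ge0 // norm2_sqr !inner_restr.
rewrite [leRHS](big_setID S) /=; move/setIidPr: ST => ->.
by rewrite lerDl sumr_ge0 // => i _; rewrite sqr_ge0.
Qed.

(** Cauchy-Schwarz against the sign vector of [x] on [S], whose norm is at most [sqrt s]. *)
Lemma norm1_restr_le s S x : (#|S| <= s)%N ->
  norm1 (restr S x) <= Num.sqrt s%:R * norm2 (restr S x).
Proof.
move=> Ss; pose w : 'cV[R]_n := \col_i (if i \in S then Num.sg (x i 0) else 0).
have -> : norm1 (restr S x) = inner w (restr S x).
  rewrite norm1_restr innerE big_mkcond; apply: eq_bigr => i _; rewrite !mxE.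
  by case: (i \in S); rewrite ?mul0r // -normrEsg.
apply: le_trans (inner_le _ _) _; apply: ler_wpM2r; first exact: norm2_ge0.
apply: ler_norm2; rewrite ?sqrtr_ge0 // sqr_sqrtr ?ler0n //.
apply: (@le_trans _ _ (\sum_(i in S) 1)); last by rewrite sumr_const ler_nat.
rewrite innerE [leRHS]big_mkcond; apply: ler_sum => i _; rewrite !mxE.
case: (i \in S); last by rewrite mul0r.
by rewrite -expr2 sqr_sg; case: eqP.
Qed.

Lemma norm2_restr_bound s S x M : 0 <= M -> (#|S| <= s)%N ->
  (forall i, i \in S -> `|x i 0| <= M) -> norm2 (restr S x) <= Num.sqrt s%:R * M.
Proof.
move=> M0 Ss xM; apply: ler_norm2; first by rewrite mulr_ge0 ?sqrtr_ge0.
rewrite exprMn sqr_sqrtr ?ler0n // inner_restr.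
apply: (@le_trans _ _ (\sum_(i in S) M ^+ 2)).
  apply: ler_sum => i iS; rewrite -real_normK ?num_real //.
  by rewrite ler_pXn2r ?nnegrE ?xM.
by rewrite sumr_const -[leLHS]mulr_natl ler_wpM2r ?sqr_ge0 // ler_nat.
Qed.

Lemma top_subset s S x : (s <= #|S|)%N ->
  exists T : {set 'I_n}, [/\ T \subset S, #|T| = s &
    forall i j, i \in T -> j \in S :\: T -> `|x j 0| <= `|x i 0|].
Proof.
elim: s => [|s IHs] sS.
  by exists set0; rewrite sub0set cards0; split=> // i j; rewrite inE.
have [T [TS Ts HT]] := IHs (ltnW sS).
have : (0 < #|S :\: T|)%N.
  by rewrite cardsD; move/setIidPr: TS => ->; rewrite Ts subn_gt0.
case/card_gt0P => i0 i0S.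
case: (@Order.TotalTheory.arg_maxP _ _ _ i0 [in S :\: T] (fun i => `|x i 0|) i0S).
move=> k kST kmax; have /setDP[kS kT] := kST.
exists (k |: T); split; first by rewrite subUset sub1set kS.
  by rewrite cardsU1 kT Ts.
move=> i j; rewrite !inE negb_or => /orP[/eqP ->|iT] /andP[/andP[_ jT] jS].
  by apply: kmax; rewrite /= !inE jT.
by apply: HT; rewrite ?inE ?jT.
Qed.

(** [M] is the smallest magnitude on the block [T], hence at most the average over [T]. If [S] has
    fewer than [s] elements, the block is all of [S] and [M = 0] works. *)
Lemma head_block s S x :
  exists (T : {set 'I_n}) (M : R), [/\ T \subset S, #|T| = minn s #|S|, 0 <= M,
    forall j, j \in S :\: T -> `|x j 0| <= M &
    s%:R * M <= norm1 (restr T x)].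
Proof.
have n1_ge0 T : 0 <= norm1 (restr T x) by exact: sumr_ge0.
case: (leqP s #|S|) => [sS|/ltnW Ss]; last first.
  exists S, 0; rewrite subxx; split=> //; first
    by move=> j; rewrite setDv inE.
  by rewrite mulr0.
have [T [TS Ts HT]] := top_subset x sS.
have [E0|[i0 i0T]] := set_0Vmem T.
  have s0 : s = 0%N by rewrite -Ts E0 cards0.
  (* For an empty block there is no smallest entry; the full sum bounds every entry, and the average
     condition is trivial because [s = 0]. *)
  exists T, (\sum_i `|x i 0|); rewrite Ts; split => //.
  - exact: sumr_ge0.
  - by move=> j _; rewrite (bigD1 j) //= lerDl sumr_ge0.
  by rewrite s0 mul0r.
case: (@Order.TotalTheory.arg_minP _ _ _ i0 [in T] (fun i => `|x i 0|) i0T).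
move=> k kT kmin; exists T, `|x k 0|; rewrite Ts; split => //.
- by move=> j; apply: HT.
rewrite norm1_restr -Ts mulr_natl -sumr_const; exact: ler_sum.
Qed.

(* Peeling off blocks of [s] largest entries, each block being bounded by the
   average of the preceding one; stating this for a subadditive [phi] avoids
   handling the sequence of blocks. *)
Lemma subadditive_restr_le (phi : 'cV[R]_n -> R) (K : R) s x :
  (0 < s)%N -> 0 <= K ->
  (forall u v, phi (u + v) <= phi u + phi v) ->
  (forall v, sparse s v -> phi v <= K * norm2 v) ->
  forall S M, 0 <= M -> (forall i, i \in S -> `|x i 0| <= M) ->
  phi (restr S x) <= K * (Num.sqrt s%:R * M + norm1 (restr S x) / Num.sqrt s%:R).
Proof.
move=> s0 K0 phiD phiK S; have [k] := ubnP #|S|; elim: k S => // k IHk S Sk M M0 xM.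
set r := Num.sqrt s%:R.
have r0 : 0 < r by rewrite sqrtr_gt0 ltr0n.
have rr : s%:R = r * r by rewrite -expr2 sqr_sqrtr ?ler0n.
have [T [M' [TS Ts M'0 xM' M's]]] := head_block s S x.
have Tles : (#|T| <= s)%N by rewrite Ts geq_minl.
have bT : phi (restr T x) <= K * (r * M).
  apply: le_trans (phiK _ (sparse_restr _ Tles)) _.
  apply: ler_wpM2l => //; apply: norm2_restr_bound => // i iT.
  by apply: xM; apply: (subsetP TS).
have [S0|SN0] := eqVneq S set0.
  have -> : restr S x = restr T x.
    by congr restr; move: TS; rewrite S0 subset0 => /eqP.
  apply: le_trans bT _; rewrite ler_wpM2l // lerDl divr_ge0 ?(ltW r0) //.
  exact: sumr_ge0.
have lt_ST : (#|S :\: T| < k)%N.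
  rewrite -ltnS; apply: leq_trans Sk; rewrite ltnS cardsD.
  by move/setIidPr: (TS) => ->; rewrite ltn_subrL Ts leq_min s0 card_gt0 SN0.
have bR := IHk _ lt_ST _ M'0 xM'.
rewrite (restr_split _ TS); apply: le_trans (phiD _ _) _.
apply: le_trans (lerD bT bR) _; rewrite -mulrDr ler_wpM2l //.
(* Since [s = r * r], the average bound gives [r * M' <= norm1 (restr T x) / r]: the cost of the
   next block is paid by the mass of [T]. *)
rewrite lerD2l -restr_split // (norm1_restr_split _ TS) mulrDl lerD2r.
by rewrite -/r ler_pdivlMr // mulrAC -rr.
Qed.

End Restriction.

(** * Consequences of the D-RIP and of minimality *)

Lemma sparseZ (R : realType) n k (a : R) (x : 'cV[R]_n) :
  sparse k x -> sparse k (a *: x).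
Proof.
apply: leq_trans; apply/subset_leq_card/subsetP => i; rewrite !inE mxE.
by apply: contraNneq => ->; rewrite mulr0.
Qed.

Lemma sparseD (R : realType) n k l (x y : 'cV[R]_n) :
  sparse k x -> sparse l y -> sparse (k + l) (x + y).
Proof.
move=> xk yl; apply: leq_trans (leq_add xk yl); apply: leq_trans (leq_card_setU _ _).
apply/subset_leq_card/subsetP => i; rewrite !inE mxE.
by apply: contraNT; rewrite negb_or !negbK => /andP[/eqP -> /eqP ->]; rewrite addr0.
Qed.

(** Polarization: add the lower D-RIP bound at [a u + c v] to the upper one at [a u - c v]. The left
    sides leave [4 a c] times the difference of inner products, and by the parallelogram law the
    right sides give [2 delta (a^2 |D u|^2 + c^2 |D v|^2)]. Keeping [<D u, D v>] in the estimate is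
    what avoids any orthogonality of the columns of [D]. *)
Lemma D_RIP_inner (R : realType) m n d s (D : 'M[R]_(n, d)) (A : 'M[R]_(m, n))
    (delta : R) (u v : 'cV[R]_d) :
  0 <= delta -> D *m D^T = 1%:M -> D_RIP D A (2 * s) delta ->
  sparse s u -> sparse s v ->
  inner (D *m u) (D *m v) - inner (A *m (D *m u)) (A *m (D *m v))
    <= delta * (norm2 u * norm2 v).
Proof.
move=> delta0 DDT rip su sv.
apply: le_of_quadratic_bound; rewrite ?norm2_ge0 // => a c.
have sp b : Sigma_D D (2 * s) (D *m (a *: u + b *: v)).
  by exists (a *: u + b *: v) => //; rewrite mul2n -addnn; apply: sparseD; apply: sparseZ.
have [_] := rip _ (sp (- c)); have [+ _] := rip _ (sp c).
have frame w : inner (D *m w) (D *m w) <= norm2 w ^+ 2.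
  by rewrite -norm2_sqr ler_pXn2r ?nnegrE ?norm2_ge0 // norm2_tight_frame.
have := lerD (ler_wpM2l (sqr_ge0 a) (frame u)) (ler_wpM2l (sqr_ge0 c) (frame v)).
move=> /(ler_wpM2l delta0).
rewrite !(mulmxDr, =^~ scalemxAr) !norm2_sqr.
rewrite !(innerDl, innerDr, innerZl, innerZr).
rewrite (innerC (D *m v) (D *m u)) (innerC (A *m (D *m v)) (A *m (D *m u))).
lra.
Qed.

(** Triangle inequalities taken separately on [S] and on its complement: a perturbation that does
    not increase the [l1]-norm must lose on [S] what it adds off [S]. *)
Lemma cone_constraint (R : realType) d (c x : 'cV[R]_d) (S : {set 'I_d}) :
  norm1 (c + x) <= norm1 c ->
  norm1 (restr (~: S) x) <= norm1 (restr S x) + 2 * norm1 (restr (~: S) c).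
Proof.
have split1 (w : 'cV[R]_d) : norm1 w = norm1 (restr S w) + norm1 (restr (~: S) w).
  rewrite !norm1_restr /norm1 (bigID [in S]) /=; congr (_ + _).
  by apply: eq_bigl => i; rewrite inE.
rewrite (split1 (c + x)) (split1 c).
have : norm1 (restr S c) <= norm1 (restr S (c + x)) + norm1 (restr S x).
  rewrite !norm1_restr -big_split /=; apply: ler_sum => i _; rewrite mxE.
  by have := ler_normB (c i 0 + x i 0) (x i 0); rewrite addrK.
have : norm1 (restr (~: S) x)
    <= norm1 (restr (~: S) (c + x)) + norm1 (restr (~: S) c).
  rewrite !norm1_restr -big_split /=; apply: ler_sum => i _; rewrite mxE.
  by have := ler_normB (c i 0 + x i 0) (c i 0); rewrite [_ - _]addrAC subrr add0r.
lra.
Qed.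

(** * The recovery estimate *)

Theorem theorem1p4 (R : realType) (delta : R)
    (delta_ge0 : 0 <= delta) (delta_lt : delta < 8%:R / 100%:R) :
  exists C0 C1 : R, [/\ 0 < C0, 0 < C1 &
    forall (m n d s : nat),
      (0 < m)%N -> (0 < n)%N -> (0 < d)%N -> (0 < s)%N -> (s <= d)%N ->
    forall (D : 'M[R]_(n, d)), D *m D^T = 1%:M ->
    forall (A : 'M[R]_(m, n)), D_RIP D A (2 * s) delta ->
    forall (eps : R), 0 <= eps ->
    forall (f : 'cV[R]_n) (z y : 'cV[R]_m),
      norm2 z <= eps -> y = A *m f + z ->
    forall (fhat : 'cV[R]_n), l1_analysis_solution D A y eps fhat ->
    forall (xs : 'cV[R]_d), best_sparse_approx s (D^T *m f) xs ->
      norm2 (fhat - f)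
        <= C0 * eps + C1 * (norm1 (D^T *m f - xs) / Num.sqrt s%:R)].
Proof.
(* From [|x| <= t + sigma <= 2 t + 2 e] and [t <= 6 eps + e], where [t] is the norm of the head of
   [x], [sigma] bounds its tail and [e] is the scaled approximation error. *)
exists 12, 4; split; [lra|lra|].
move=> m n d s _ _ _ s0 _ D DDT A rip eps eps0 f z y zeps yE fhat [feas opt] xs.
case=> T0 [T0s _ xsE].
set c := D^T *m f; set h := fhat - f; set r := Num.sqrt s%:R.
set e := norm1 (c - xs) / r; pose x := D^T *m h.
have r0 : 0 < r by rewrite sqrtr_gt0 ltr0n.
have rr : s%:R = r * r by rewrite -expr2 sqr_sqrtr ?ler0n.
have hE : h = D *m x by rewrite mulmxA DDT mul1mx.
have tube : norm2 (A *m h) <= 2 * eps.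
  have -> : A *m h = (A *m fhat - y) + z.
    by rewrite yE mulmxBr opprD addrA subrK.
  by apply: le_trans (norm2D _ _) _; lra.
have cxsE : norm1 (c - xs) = norm1 (restr (~: T0) c).
  apply: eq_bigr => i _; rewrite !mxE xsE !inE /c !mxE.
  by case: (i \in T0); rewrite /= ?subrr ?subr0.
have cone : norm1 (restr (~: T0) x) <= norm1 (restr T0 x) + 2 * norm1 (c - xs).
  rewrite cxsE; apply: cone_constraint.
  (* Here [c + x] is [D^T fhat], and [f] is a feasible competitor because [A f - y = - z]. *)
  rewrite -mulmxDr /h addrC subrK; apply: opt.
  by rewrite yE opprD addrA subrr add0r norm2N.
have [T1 [M [T1S T1s M0 xM Ms]]] := head_block s (~: T0) x.
have {}T1s : (#|T1| <= s)%N by rewrite T1s geq_minl.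
set tail := ~: T0 :\: T1.
pose u := restr T0 x + restr T1 x.
have uE : u = restr (T0 :|: T1) x.
  rewrite /u (@restr_split _ _ (T0 :|: T1) T0) ?subsetUl //.
  congr (_ + _); congr restr; rewrite setDUl setDv set0U; apply/esym/setDidPl.
  by rewrite disjoints_subset.
have xE : x = u + restr tail x.
  by rewrite {1}(restrTC T0 x) (restr_split x T1S) addrA.
set t := norm2 u.
have t0 : 0 <= t by exact: norm2_ge0.
have T0t : norm2 (restr T0 x) <= t by rewrite /t uE norm2_restr_le ?subsetUl.
have T1t : norm2 (restr T1 x) <= t by rewrite /t uE norm2_restr_le ?subsetUr.
(* The bound of [subadditive_restr_le] on the tail with [K = 1]; it serves below for both [norm2]
   and [G u]. *)
pose sigma := r * M + norm1 (restr tail x) / r.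
have sigma_le : sigma <= t + 2 * e.
  apply: (@le_trans _ _ (norm1 (restr (~: T0) x) / r)).
    rewrite (norm1_restr_split _ T1S) mulrDl lerD2r.
    by rewrite ler_pdivlMr // mulrAC -rr.
  rewrite ler_pdivrMr // mulrDl -mulrA divfK ?gt_eqF //.
  apply: le_trans cone _; rewrite lerD2r.
  apply: le_trans (norm1_restr_le _ (eq_leq T0s)) _.
  by rewrite mulrC ler_pM2r.
have tail_le : norm2 (restr tail x) <= sigma.
  rewrite -[leRHS]mul1r; apply: subadditive_restr_le => //; first exact: norm2D.
  by move=> v _; rewrite mul1r.
(* [G] is the bilinear form measuring how far [A] is from preserving inner products on the range of
   [D]. *)
pose G w v := inner (D *m w) (D *m v) - inner (A *m (D *m w)) (A *m (D *m v)).
have GDr w v1 v2 : G w (v1 + v2) = G w v1 + G w v2.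
  by rewrite /G !(mulmxDr, innerDr) opprD addrACA.
have GDl w1 w2 v : G (w1 + w2) v = G w1 v + G w2 v.
  by rewrite /G !(mulmxDr, innerDl) opprD addrACA.
(* The factor 2 comes from splitting [u] into its [T0] and [T1] parts: each is [s]-sparse of norm at
   most [t], so paired with an [s]-sparse block it needs only order [2 * s]. *)
have G_tail : G u (restr tail x) <= 2 * delta * t * sigma.
  apply: subadditive_restr_le => //.
  - by rewrite !mulr_ge0 // ltW.
  - by move=> v1 v2; rewrite GDr.
  move=> v sv; rewrite GDl.
  have b0 := D_RIP_inner delta_ge0 DDT rip (sparse_restr x (eq_leq T0s)) sv.
  have b1 := D_RIP_inner delta_ge0 DDT rip (sparse_restr x T1s) sv.
  have v0 := ler_wpM2r (norm2_ge0 v) T0t.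
  have v1 := ler_wpM2r (norm2_ge0 v) T1t.
  have := ler_wpM2l delta_ge0 (lerD v0 v1).
  by move: b0 b1; rewrite -/(G _ _) -/(G _ _); lra.
have su : Sigma_D D (2 * s) (D *m u).
  exists u => //; rewrite mul2n -addnn; apply: sparseD; apply: sparse_restr => //.
  by rewrite T0s.
have [rip_lo rip_hi] := rip _ su.
have Dut : norm2 (D *m u) ^+ 2 <= t ^+ 2.
  by rewrite ler_pXn2r ?nnegrE ?norm2_ge0 // norm2_tight_frame.
have G_head : G u u <= delta * t ^+ 2.
  by have := ler_wpM2l delta_ge0 Dut; rewrite /G -!norm2_sqr; lra.
(* A crude bound: [1 + delta <= 4]. *)
have ADu : norm2 (A *m (D *m u)) <= 2 * t.
  apply: ler_norm2; first lra.
  rewrite -norm2_sqr; apply: le_trans rip_hi _.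
  by have := ler_wpM2l (addr_ge0 ler01 delta_ge0) Dut; nra.
have GuxE : G u x = t ^+ 2 - inner (A *m (D *m u)) (A *m h).
  rewrite /G -hE; congr (_ - _).
  by rewrite inner_mull -/x norm2_sqr uE inner_restrl.
(* Expand [G u x = G u u + G u (restr tail x)] and insert the bounds on both terms. *)
have key : t ^+ 2 <= 4 * t * eps + delta * t ^+ 2 + 2 * delta * t * (t + 2 * e).
  have : inner (A *m (D *m u)) (A *m h) <= 2 * t * (2 * eps).
    apply: le_trans (inner_le _ _) _.
    by rewrite ler_pM ?norm2_ge0.
  have : 2 * delta * t * sigma <= 2 * delta * t * (t + 2 * e).
    by rewrite ler_wpM2l // !mulr_ge0 // ltW.
  by have := GDr u u (restr tail x); rewrite -xE GuxE; lra.
have e0 : 0 <= e by rewrite divr_ge0 ?(ltW r0) ?sumr_ge0.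
(* Dividing [key] by [t] gives [(1 - 3 delta) t <= 4 eps + 4 delta e]. With [delta < 0.08] the
   factor on the left exceeds [0.76], and [4 / 0.76 < 6], [0.32 / 0.76 < 1]. *)
have t_le : t <= 6 * eps + e.
  have [t00|tN0] := eqVneq t 0; first by rewrite t00; lra.
  have tpos : 0 < t by rewrite lt_def tN0.
  have : t <= 4 * eps + delta * t + 2 * delta * (t + 2 * e).
    by rewrite -(ler_pM2l tpos); move: key; lra.
  by nra.
have -> : norm2 h = norm2 x.
  apply/eqP; rewrite -(eqrXn2 (n := 2)) ?norm2_ge0 // !norm2_sqr {2}/x.
  by rewrite inner_mull trmxK -hE.
rewrite xE; apply: le_trans (norm2D _ _) _.
by move: tail_le sigma_le t_le; rewrite -/t; lra.
Qed.
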